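(* Let $r,m$ be integers with $0<r<m$ and $\gcd(r,m)=1$, and let $\frac rm=[0;a_1,a_2,\dots,a_n]$ be a simple continued fraction expansion of $r/m$ (either one of its two expansions), with convergents $p_k/q_k$. Then \[H(\tfrac rm)=\min_{0\le k<n/2}\Big\{\,q_{2k}\,\frac{r+1}{m}-p_{2k}\Big\}.\]
   Context: For relatively prime positive integers $r,m$, $H(r/m)=\min\{k/m+\{kr/m\}:1\le k<m\}$, where $\{x\}=x-\lfloor x\rfloor$. For $[0;a_1,\dots,a_n]$ with $a_0=0$ and positive integers $a_1,\dots,a_n$, the convergents $p_k/q_k=[a_0;a_1,\dots,a_k]$ are given by $p_{-2}=0,p_{-1}=1$, $q_{-2}=1,q_{-1}=0$, and $p_k=a_kp_{k-1}+p_{k-2}$, $q_k=a_kq_{k-1}+q_{k-2}$ for $k\ge 0$; in particular $p_0/q_0=0/1$. *)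

(* Defs.v *)
From mathcomp Require Import all_boot all_order all_algebra.
Set Implicit Arguments.
Unset Strict Implicit.
Unset Printing Implicit Defensive.
Import Order.TTheory GRing.Theory Num.Theory.
Local Open Scope ring_scope.

(* The minimum of F over a nonempty sequence s.  The unit of the iterated
   minimum is a value of F on s, so it does not affect the result; on the empty
   sequence, where there is no minimum, the value is the meaningless F 0. *)
Definition min_over (s : seq nat) (F : nat -> rat) : rat :=
  \big[Num.min/F (head 0%N s)]_(k <- s) F k.

Definition fracpart (x : rat) : rat := x - (Num.floor x)%:~R.

Definition H (r m : nat) : rat :=
  min_over (index_iota 1 m)
    (fun k => k%:R / m%:R + fracpart (k%:R * r%:R / m%:R)).

(* [a0; a_1, ..., a_n] for a = [:: a_1; ...; a_n] *)
Fixpoint cfrac (a0 : nat) (a : seq nat) : rat :=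
  if a is a1 :: a' then a0%:R + (cfrac a1 a')^-1 else a0%:R.

(* The sequence x_{-2} = u, x_{-1} = v, x_k = c_k x_{k-1} + x_{k-2} with its
   index shifted by 2: cf_rec c u v j is x_{j-2}. *)
Fixpoint cf_rec (c : nat -> nat) (u v : nat) (j : nat) : nat :=
  match j with
  | 0 => u
  | 1 => v
  | (k.+1 as k1).+1 => c k * cf_rec c u v k1 + cf_rec c u v k
  end%N.

(* p_k and q_k for [0; a_1, ..., a_n], where a = [:: a_1; ...; a_n]; they are
   meaningful for k <= n. *)
Definition conv_num (a : seq nat) (k : nat) : nat :=
  cf_rec (nth 0%N (0%N :: a)) 0 1 k.+2.

Definition conv_den (a : seq nat) (k : nat) : nat :=
  cf_rec (nth 0%N (0%N :: a)) 1 0 k.+2.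

(* Main.v *)
(* To 0 < k < m associate the lattice point v = (k, kr - ym), y = floor(kr/m),
   of the positive quadrant; m (k/m + {kr/m}) is the value at v of the linear
   form f(x, z) = x + z.  Let v_k = (q_k, q_k r - p_k m).  The v_k with k even
   lie in the quadrant, and v_(k+2) = v_k + a_(k+2) v_(k+1), where f(v_k)
   increases along odd k from f(v_(-1)) = -m < 0 to a nonnegative value at the
   last odd index.  Let 2j + 1 be the first odd index with f(v_(2j+1)) >= 0.
   Each lattice point v of the open quadrant is an integral combination both of
   v_2j, v_(2j+1) and of v_2j, v_(2j-1), and one of the two shows
   f(v) >= f(v_2j). *)
Require Import Defs.
From mathcomp Require Import all_boot all_order all_algebra.
From mathcomp Require Import zify ring.
Import Order.TTheory GRing.Theory Num.Theory.
Local Open Scope ring_scope.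

Lemma min_over_eq (s : seq nat) (F : nat -> rat) (x : nat) :
  x \in s -> {in s, forall y, F x <= F y} -> min_over s F = F x.
Proof.
move=> xs Fx_min; apply/eqP; rewrite eq_le /min_over; apply/andP; split.
  (* The unit depends on the head of [s], which changes along the induction, so it is generalized
     first. *)
  move: (F (head 0%N s)) => z.
  elim: s xs {Fx_min} => // y s IHs; rewrite big_cons inE ge_min.
  by case/orP=> [/eqP <-|/IHs ->]; rewrite ?lexx ?orbT.
have Fx_head : F x <= F (head 0%N s).
  by case: s xs Fx_min => // y s _; apply; rewrite inE eqxx.
rewrite big_seq; elim/big_ind: _ => // u v le_u le_v.
by rewrite le_min le_u.
Qed.

Lemma fracpart_div (k m : nat) :
  (0 < m)%N -> fracpart (k%:R / m%:R) = (k %% m)%N%:R / m%:R.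
Proof.
move=> m_gt0; have m_neq0 : m%:R != 0 :> rat by rewrite pnatr_eq0 -lt0n.
have kE : k%:R / m%:R = (k %/ m)%N%:R + (k %% m)%N%:R / m%:R :> rat.
  by rewrite {1}(divn_eq k m) natrD natrM mulrDl mulfK.
have -> : fracpart (k%:R / m%:R) = k%:R / m%:R - (k %/ m)%N%:R.
  rewrite /fracpart (@Num.Theory.floor_def _ _ (k %/ m)%N%:Z) //.
  rewrite -[_ + 1%Z]/((k %/ m)%N%:Z + 1) rmorphD /= kE lerDl.
  rewrite divr_ge0 ?ler0n //= ltrD2l ltr_pdivrMr ?ltr0n //.
  by rewrite mul1r ltr_nat ltn_mod.
by rewrite kE addrC addKr.
Qed.

Lemma cf_recSS (c : nat -> nat) (u v i : nat) :
  cf_rec c u v i.+2 = (c i * cf_rec c u v i.+1 + cf_rec c u v i)%N.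
Proof. by []. Qed.

(** The recursion adds coefficients at the end, whereas [cfrac] unfolds from the front; absorbing
    [c 0] into the seeds reconciles the two. *)
Lemma cf_rec_shift (c : nat -> nat) (u v i : nat) :
  cf_rec c u v i.+1 = cf_rec (fun j => c j.+1) v (c 0 * v + u)%N i.
Proof.
suff: cf_rec c u v i.+1 = cf_rec (fun j => c j.+1) v (c 0 * v + u)%N i /\
      cf_rec c u v i.+2 = cf_rec (fun j => c j.+1) v (c 0 * v + u)%N i.+1 by case.
elim: i => // i [IH1 IH2]; split=> //.
by rewrite cf_recSS IH1 IH2.
Qed.

Lemma cfrac_gt0 (a0 : nat) (a : seq nat) :
  (0 < a0)%N -> (forall i, i \in a -> (0 < i)%N) -> 0 < cfrac a0 a.
Proof.
elim: a a0 => [|a1 a IHa] a0 a0_gt0 a_pos /=; first by rewrite ltr0n.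
apply: addr_gt0; rewrite ?ltr0n // invr_gt0 IHa // => [|i ai].
  by apply: a_pos; rewrite inE eqxx.
by apply: a_pos; rewrite inE ai orbT.
Qed.

(** Peeling off [a0] changes the seeds, hence the arbitrary [u] and [v]. The seeds 0 and 1 give the
    value of the last convergent. *)
Lemma cf_rec_cfrac (a0 : nat) (a : seq nat) (u v : nat) :
  (forall i, i \in a -> (0 < i)%N) ->
  (cf_rec (nth 0%N (a0 :: a)) u v (size a).+2)%:R =
  (cf_rec (nth 0%N (a0 :: a)) 1 0 (size a).+2)%:R
    * (cfrac a0 a * v%:R + u%:R) :> rat.
Proof.
elim: a a0 u v => [|a1 a IHa] a0 u v a_pos.
  by rewrite /= muln0 add0n mul1r natrD natrM.
have a1_gt0 : (0 < a1)%N by apply: a_pos; rewrite inE eqxx.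
have a_pos' i : i \in a -> (0 < i)%N by move=> ai; apply: a_pos; rewrite inE ai orbT.
rewrite [size _]/= !cf_rec_shift [RHS]mulrC.
have := IHa a1 v (a0 * v + u)%N a_pos'; rewrite !cf_rec_shift => ->.
have := IHa a1 0%N (a0 * 0 + 1)%N a_pos'; rewrite !cf_rec_shift => ->.
have /lt0r_neq0 x_neq0 := cfrac_gt0 _ _ a1_gt0 a_pos'.
rewrite /= muln0 add0n natrD natrM; field.
exact: x_neq0.
Qed.

Lemma cf_rec_det (c : nat -> nat) (i : nat) :
  (cf_rec c 0 1 i.+1)%:Z * (cf_rec c 1 0 i)%:Z
    - (cf_rec c 0 1 i)%:Z * (cf_rec c 1 0 i.+1)%:Z = (-1) ^+ i.
Proof.
elim: i => // i IHi.
by rewrite exprS -IHi !cf_recSS !PoszD !PoszM; ring.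
Qed.

Lemma leq_cf_recSS (c : nat -> nat) (u v i : nat) :
  (cf_rec c u v i <= cf_rec c u v i.+2)%N.
Proof. by rewrite cf_recSS leq_addl. Qed.

Lemma cf_rec_den_even_gt0 (c : nat -> nat) (j : nat) :
  (0 < cf_rec c 1 0 (2 * j))%N.
Proof.
elim: j => // j IHj; rewrite mulnS.
exact: leq_trans IHj (leq_cf_recSS _ _ _ _).
Qed.

(* The lattice point [k : y] is [al (q : p) + be (q1 : p1)], and
   also [al' (q : p) + be (q0 : p0)]; positivity forces [al > 0] and, when
   [be < 0], also [al' > 0].  Use the first form if [be >= 0], else the second. *)
Lemma lattice_min (r m c q p q0 p0 q1 p1 k y : int) :
  p1 * q - p * q1 = 1 -> q1 = c * q + q0 -> p1 = c * p + p0 ->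
  0 < q -> 0 <= q0 -> 0 <= q1 ->
  0 <= r * q - m * p -> r * q1 - m * p1 <= 0 ->
  (r + 1) * q0 - m * p0 <= 0 -> 0 <= (r + 1) * q1 - m * p1 ->
  0 < k -> 0 < r * k - m * y ->
  (r + 1) * q - m * p <= (r + 1) * k - m * y.
Proof.
move=> det q1E p1E q_gt0 q0_ge0 q1_ge0 D_ge0 D1_le0 f0_le0 f1_ge0 k_gt0 x_gt0.
set al := k * p1 - y * q1; set be := y * q - k * p.
have kE : k = al * q + be * q1.
  by rewrite -[LHS]mulr1 -det /al /be; ring.
have yE : y = al * p + be * p1.
  by rewrite -[LHS]mulr1 -det /al /be; ring.
clearbody al be.
have al_gt0 : 0 < al.
  (* With [al <= 0], the case [be >= 0] makes [r * k - m * y] nonpositive, and [be < 0] makes [k]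
     nonpositive. *)
  rewrite ltNge; apply/negP => al_le0.
  have be_lt0 : be < 0.
    rewrite ltNge; apply/negP => be_ge0.
    have : r * k - m * y = al * (r * q - m * p) + be * (r * q1 - m * p1).
      by rewrite kE yE; ring.
    nia.
  nia.
have f_ge0 : 0 <= (r + 1) * q - m * p by lia.
have [be_ge0|be_lt0] := lerP 0 be.
  have -> : (r + 1) * k - m * y =
      al * ((r + 1) * q - m * p) + be * ((r + 1) * q1 - m * p1).
    by rewrite kE yE; ring.
  nia.
have al'_gt0 : 0 < al + be * c.
  rewrite ltNge; apply/negP => al'_le0.
  have : k = (al + be * c) * q + be * q0 by rewrite kE q1E; ring.
  nia.
have -> : (r + 1) * k - m * y =
    (al + be * c) * ((r + 1) * q - m * p) + be * ((r + 1) * q0 - m * p0).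
  by rewrite kE yE q1E p1E; ring.
nia.
Qed.

(* Indices are those of [cf_rec], shifted by 2: parities are unchanged. *)
Lemma signed_defect_gt0 (c : nat -> nat) (n r m : nat) :
  (forall i, (0 < i <= n)%N -> (0 < c i)%N) ->
  cf_rec c 0 1 n.+2 = r -> cf_rec c 1 0 n.+2 = m ->
  forall i, (0 < i <= n.+1)%N ->
  0 < (-1) ^+ i * (r%:Z * (cf_rec c 1 0 i)%:Z - m%:Z * (cf_rec c 0 1 i)%:Z).
Proof.
move=> c_gt0 rE mE.
set e := fun i =>
  (-1) ^+ i * (r%:Z * (cf_rec c 1 0 i)%:Z - m%:Z * (cf_rec c 0 1 i)%:Z).
have e_n2 : e n.+2 = 0 by rewrite /e rE mE; ring.
have e_n1 : e n.+1 = 1.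
  have := cf_rec_det c n.+1; rewrite rE mE /e => detE.
  rewrite [m%:Z * _]mulrC detE -expr2 -exprM mulnC exprM.
  by rewrite sqrrN !expr1n.
have eSS i : e i = e i.+2 + (c i)%:Z * e i.+1.
  by rewrite /e !cf_recSS !PoszD !PoszM !exprS; ring.
(* Downward induction from the values 1 and 0 at the end: with signs absorbed, [eSS] has only
   nonnegative terms. *)
suff e_pos d : (d <= n)%N -> 0 < e (n.+1 - d)%N /\ 0 <= e (n.+2 - d)%N.
  move=> i /andP[i_gt0 le_in].
  have /e_pos[] : (n.+1 - i <= n)%N by lia.
  by rewrite subKn.
elim: d => [|d IHd] le_dn; first by rewrite !subn0 e_n1 e_n2.
have [|e1 e2] := IHd; first by lia.
split; last by rewrite subSS ltW.
have n1E : (n.+1 - d = (n.+1 - d.+1).+1)%N by lia.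
have n2E : (n.+2 - d = (n.+1 - d.+1).+2)%N by lia.
rewrite n1E in e1; rewrite n2E in e2.
by rewrite eSS ltr_wpDl // mulr_gt0 // ltz_nat c_gt0 //; lia.
Qed.

Theorem theorem2p5 (r m : nat) (a : seq nat)
    (r_gt0 : (0 < r)%N) (r_lt_m : (r < m)%N) (r_m_coprime : coprime r m)
    (a_pos : forall i : nat, i \in a -> (0 < i)%N)
    (r_m_cfrac : r%:R / m%:R = cfrac 0 a) :
  H r m =
    min_over [seq k <- iota 0 (size a) | (2 * k < size a)%N]
      (fun k => (conv_den a (2 * k))%:R * ((r%:R + 1) / m%:R)
                - (conv_num a (2 * k))%:R).
Proof.
have m_gt0 : (0 < m)%N by lia.
have m_neq0 : m%:R != 0 :> rat by rewrite pnatr_eq0 -lt0n.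
pose c := nth 0%N (0%N :: a); pose n := size a.
pose P := cf_rec c 0 1; pose Q := cf_rec c 1 0.
have n_gt0 : (0 < n)%N.
  rewrite /n; case: a r_m_cfrac {a_pos c n P Q} => //= /eqP.
  by rewrite mulf_eq0 invr_eq0 !pnatr_eq0; lia.
have PQ_last : (P n.+2 * m = Q n.+2 * r)%N.
  apply/eqP; rewrite -(@eqr_nat rat) !natrM /P /Q /n /c cf_rec_cfrac //.
  by rewrite -r_m_cfrac; apply/eqP; field.
(* The last convergent is reduced, by the determinant identity, and so is r/m; equal reduced
   fractions have the same terms. *)
have PQ_coprime : coprime (P n.+2) (Q n.+2).
  have det := cf_rec_det c n.+1; rewrite -/P -/Q in det.
  rewrite /coprime -dvdn1.
  have : ((gcdn (P n.+2) (Q n.+2))%:Z %| (-1) ^+ n.+1)%Z.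
    rewrite -det rpredB //.
      by rewrite dvdz_mulr // dvdzE dvdn_gcdl.
    by rewrite dvdz_mull // dvdzE dvdn_gcdr.
  by rewrite dvdzE abszX abszN absz1 exp1n.
have P_last : P n.+2 = r.
  apply/eqP; rewrite eqn_dvd; apply/andP; split.
    by rewrite -(Gauss_dvdr r PQ_coprime) -PQ_last dvdn_mulr.
  by rewrite -(Gauss_dvdl (P n.+2) r_m_coprime) PQ_last dvdn_mull.
have Q_last : Q n.+2 = m.
  by move: PQ_last; rewrite P_last mulnC => /eqP; rewrite eqn_pmul2r // => /eqP.
pose D i : int := r%:Z * (Q i)%:Z - m%:Z * (P i)%:Z.
pose f i : int := (r%:Z + 1) * (Q i)%:Z - m%:Z * (P i)%:Z.
have c_gt0 i : (0 < i <= n)%N -> (0 < c i)%N.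
  by case: i => // i lt_in; apply/a_pos/mem_nth.
have D_sign := @signed_defect_gt0 c n r m c_gt0 P_last Q_last.
have D_even j : (2 * j < n)%N -> 0 < D (2 * j).+2.
  move=> lt_jn; have /D_sign : (0 < (2 * j).+2 <= n.+1)%N by lia.
  by rewrite -[(2 * j).+2]addn2 exprD exprM sqrrN !expr1n !mul1r.
have D_odd j : (2 * j < n)%N -> D (2 * j).+3 <= 0.
  move=> lt_jn; have [->|ne_jn] := eqVneq (2 * j).+3 n.+2.
    by rewrite /D P_last Q_last mulrC subrr.
  have /D_sign : (0 < (2 * j).+3 <= n.+1)%N by lia.
  rewrite -[(2 * j).+3]addn3 exprD exprM sqrrN !expr1n !mul1r.
  by rewrite exprS sqrrN expr1n mulr1 mulN1r oppr_gt0 => /ltW.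
(* At index [n.+2] the form equals [m]. At [n.+1] the determinant makes it [Q n.+1 - 1], and
   [Q n.+1 = 0] would force [m = 1]. *)
have f_last_ge0 : 0 <= f (2 * (n.-1 %/ 2)).+3.
  have [nE|nE] : (2 * (n.-1 %/ 2)).+3 = n.+2 \/
      (2 * (n.-1 %/ 2)).+3 = n.+1 by lia.
    by rewrite nE /f P_last Q_last; lia.
  have := cf_rec_det c n.+1; rewrite -/P -/Q P_last Q_last -nE.
  rewrite -[(2 * _).+3]addn3 exprD exprM sqrrN !expr1n mul1r.
  rewrite exprS sqrrN expr1n mulr1 addn3 /f.
  move: (P _) (Q _) => p [|q] det; last by lia.
  by case: p det => [|p]; nia.
case: (ex_minnP (ex_intro (fun j => 0 <= f (2 * j).+3) _ f_last_ge0)).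
move=> j fj_ge0 j_min.
have lt_jn : (2 * j < n)%N by have := j_min _ f_last_ge0; lia.
have f_pred_le0 : f (2 * j).+1 <= 0.
  case: j j_min {fj_ge0 lt_jn} => [|j] j_min; first by rewrite /f /P /Q /=; lia.
  rewrite leNgt; apply/negP => /ltW f_ge0.
  have := j_min j; rewrite -[(2 * j).+3]/((2 + 2 * j).+1) -mulnS ltnn.
  by move=> /(_ f_ge0).
have Q_even_gt0 i : (0 < Q (2 * i).+2)%N.
  by rewrite -[(2 * i).+2]/(2 + 2 * i)%N -mulnS cf_rec_den_even_gt0.
have f_min (k y : nat) : (0 < k)%N -> 0 < r%:Z * k%:Z - m%:Z * y%:Z ->
    f (2 * j).+2 <= (r%:Z + 1) * k%:Z - m%:Z * y%:Z.
  move=> k_gt0 x_gt0.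
  apply: (@lattice_min r m (c (2 * j).+1) (Q (2 * j).+2) (P (2 * j).+2)
    (Q (2 * j).+1) (P (2 * j).+1) (Q (2 * j).+3) (P (2 * j).+3)) => //.
  - rewrite (cf_rec_det c (2 * j).+2) -addn2 exprD exprM sqrrN !expr1n.
    by rewrite mulr1.
  - exact: Q_even_gt0.
  - exact/ltW/D_even.
  - exact: D_odd.
have fE (k y : nat) : ((r%:Z + 1) * k%:Z - m%:Z * y%:Z)%:~R / m%:R
    = k%:R * ((r%:R + 1) / m%:R) - y%:R :> rat.
  by rewrite rmorphB !rmorphM rmorphD /=; field.
have F_min (k y : nat) : (0 < k)%N -> 0 < r%:Z * k%:Z - m%:Z * y%:Z ->
    (Q (2 * j).+2)%:R * ((r%:R + 1) / m%:R) - (P (2 * j).+2)%:R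
      <= k%:R * ((r%:R + 1) / m%:R) - y%:R :> rat.
  move=> k_gt0 x_gt0; rewrite -!fE ler_pM2r ?invr_gt0 ?ltr0n // ler_int.
  exact: f_min.
(* Each competitor of [H] is the form at the lattice point of [k], divided by [m]. *)
have HE (k : nat) : k%:R / m%:R + fracpart (k%:R * r%:R / m%:R)
    = k%:R * ((r%:R + 1) / m%:R) - (k * r %/ m)%N%:R.
  rewrite -natrM fracpart_div //.
  have /(congr1 (fun x => x%:R : rat)) := divn_eq (k * r) m.
  rewrite natrD !natrM => krE.
  have -> : k%:R * ((r%:R + 1) / m%:R) = k%:R / m%:R + k%:R * r%:R / m%:R :> rat.
    by field.
  by rewrite krE; field.
(* The even convergents are themselves lattice points of the open quadrant, so [F_min] applies to
   them too. *)
rewrite (@min_over_eq _ _ j); first last.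
- move=> i; rewrite mem_filter mem_iota => /andP[lt_in _].
  by apply: F_min; [exact: Q_even_gt0 | exact: D_even].
- by rewrite mem_filter mem_iota lt_jn /=; lia.
(* Comparison with the lattice point of k = 1 bounds both coordinates by m, so
   that k = q_{2j} is one of the competitors in the definition of H. *)
have f_le_m : f (2 * j).+2 <= m%:Z.
  by apply: le_trans (f_min 1%N 0%N _ _) _ => //; lia.
have Dj_gt0 := D_even j lt_jn; have Qj_gt0 := Q_even_gt0 j.
have fD : f (2 * j).+2 = D (2 * j).+2 + (Q (2 * j).+2)%:Z by rewrite /f /D; ring.
(* Since [D + Q <= m] and [Q > 0], [D] lies strictly between 0 and [m]: it is a remainder modulo
   [m]. *)
have P_floor : (Q (2 * j).+2 * r %/ m)%N = P (2 * j).+2.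
  have -> : (Q (2 * j).+2 * r = P (2 * j).+2 * m + `|D (2 * j).+2|)%N.
    by move: Dj_gt0; rewrite /D; lia.
  by rewrite divnMDl // divn_small ?addn0 //; lia.
rewrite /H (@min_over_eq _ _ (Q (2 * j).+2)).
- by rewrite HE P_floor.
- by rewrite mem_index_iota Qj_gt0 /=; lia.
move=> k; rewrite mem_index_iota => /andP[k_gt0 lt_km].
rewrite !HE P_floor; apply: F_min => //.
(* Coprimality and [0 < k < m] keep the point of [k] off the axis. *)
have : (0 < k * r %% m)%N.
  rewrite lt0n -/(dvdn m (k * r)) Gauss_dvdl 1?coprime_sym //.
  by apply/negP => /(dvdn_leq k_gt0); lia.
by have := divn_eq (k * r) m; lia.
Qed.
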